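(* Suppose that a group $G$ acts geometrically on a CAT(0) space $X$ with fixed basepoint $x_0$ and $|\partial X|>2$. Assume that there exists a constant $M>0$ such that for any $\alpha,\beta\in\partial X$ with $\alpha\neq\beta$, there exist a sequence $\{g_i\}\subset G$ and a point $y_0\in X$ such that $d(y_0,g_ix_0)\to\infty$ as $i\to\infty$ and for every $i\in\mathbb{N}$, $$\operatorname{Im}\xi_{g_ix_0,\alpha}\cap B(y_0,M)\neq\emptyset\quad\text{and}\quad\operatorname{Im}\xi_{g_ix_0,\beta}\cap B(y_0,M)\neq\emptyset.$$ Then the boundary $\partial X$ is a scrambled set.
   Context: A geometric action is an action by isometries which is proper and cocompact. $\partial X$ is the visual boundary of $X$, on which $G$ acts by homeomorphisms. For $x\in X$ and $\alpha\in\partial X$, $\xi_{x,\alpha}$ denotes the unique geodesic ray with $\xi_{x,\alpha}(0)=x$ and $\xi_{x,\alpha}(\infty)=\alpha$; $B(y_0,M)$ is the closed ball. The metric on $\partial X$ is $d_{\partial X}(\alpha,\beta)=\sum_{i=1}^\infty\min\{d(\xi_{x_0,\alpha}(i),\xi_{x_0,\beta}(i)),\,2^{-i}\}$. $\partial X$ is a scrambled set if for all $\alpha\neq\beta$ in $\partial X$, $\limsup\{d_{\partial X}(g\alpha,g\beta)\mid g\in G\}>0$ and $\liminf\{d_{\partial X}(g\alpha,g\beta)\mid g\in G\}=0$, where limsup/liminf are taken as $g$ leaves every finite subset of $G$. *)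

(* Defs.v *)
From Stdlib Require Import Reals Lra List ClassicalEpsilon.
From Coquelicot Require Import Coquelicot.
Open Scope R_scope.

Section Defs.
Context {X : Type} (d : X -> X -> R).

Definition is_metric : Prop :=
  (forall x y, 0 <= d x y) /\ (forall x y, d x y = 0 <-> x = y) /\
  (forall x y, d x y = d y x) /\ (forall x y z, d x z <= d x y + d y z).

Definition geodesic_from_to (c : R -> X) (x y : X) : Prop :=
  c 0 = x /\ c (d x y) = y /\
  forall s t, 0 <= s <= d x y -> 0 <= t <= d x y -> d (c s) (c t) = Rabs (s - t).

Definition geodesic_space : Prop :=
  forall x y, exists c, geodesic_from_to c x y.

Definition eucl (P Q : R * R) : R :=
  sqrt ((fst P - fst Q) ^ 2 + (snd P - snd Q) ^ 2).

(** CAT(0) inequality for a pair of sides of a geodesic triangle: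
    side (c, L, A, B) is a geodesic c : [0,L] -> X whose comparison segment in
    the plane is [A,B]; the comparison point of c s is the point E of [A,B]
    with |E - A| = s and |E - B| = L - s. *)
Definition cat0_pair (σ τ : (R -> X) * R * (R * R) * (R * R)) : Prop :=
  let '(c, L, A, B) := σ in
  let '(c', L', A', B') := τ in
  forall s t E F, 0 <= s <= L -> 0 <= t <= L' ->
    eucl E A = s -> eucl E B = L - s ->
    eucl F A' = t -> eucl F B' = L' - t ->
    d (c s) (c' t) <= eucl E F.

(** CAT(0) space (Bridson-Haefliger II.1.1): a geodesic metric space all of whose
    geodesic triangles satisfy the CAT(0) inequality w.r.t. Euclidean
    comparison triangles. *)
Definition CAT0 : Prop :=
  is_metric /\ geodesic_space /\
  forall (p q r : X) (c1 c2 c3 : R -> X) (P Q Rr : R * R),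
    geodesic_from_to c1 p q -> geodesic_from_to c2 q r -> geodesic_from_to c3 r p ->
    eucl P Q = d p q -> eucl Q Rr = d q r -> eucl Rr P = d r p ->
    let sides := (c1, d p q, P, Q) :: (c2, d q r, Q, Rr) :: (c3, d r p, Rr, P) :: nil in
    forall σ τ, In σ sides -> In τ sides -> cat0_pair σ τ.

Definition is_open (U : X -> Prop) : Prop :=
  forall x, U x -> exists e, 0 < e /\ forall y, d x y < e -> U y.

Definition compact (K : X -> Prop) : Prop :=
  forall (I : Type) (U : I -> X -> Prop),
    (forall i, is_open (U i)) -> (forall x, K x -> exists i, U i x) ->
    exists l : list I, forall x, K x -> exists i, In i l /\ U i x.

(** geodesic rays and asymptoticity; the visual boundary ∂X is the set of
    rays modulo asymptoticity *)
Definition is_ray (r : R -> X) : Prop :=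
  forall s t, 0 <= s -> 0 <= t -> d (r s) (r t) = Rabs (s - t).

Definition asymp (r r' : R -> X) : Prop :=
  exists C, forall t, 0 <= t -> d (r t) (r' t) <= C.

Definition xi (x : X) (a : R -> X) : R -> X :=
  epsilon (inhabits a) (fun r => is_ray r /\ r 0 = x /\ asymp a r).

Definition dbd (x0 : X) (a b : R -> X) : R :=
  Series (fun n => Rmin (d (xi x0 a (INR (S n))) (xi x0 b (INR (S n))))
                        (/ 2 ^ (S n))).
End Defs.

Section Group.
Context {G : Type}.

Definition is_group (mul : G -> G -> G) (e : G) (inv : G -> G) : Prop :=
  (forall a b c, mul a (mul b c) = mul (mul a b) c) /\
  (forall a, mul e a = a /\ mul a e = a) /\
  (forall a, mul (inv a) a = e /\ mul a (inv a) = e).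

Context {X : Type} (d : X -> X -> R).

Definition isometric_action (mul : G -> G -> G) (e : G) (act : G -> X -> X) : Prop :=
  (forall x, act e x = x) /\
  (forall g h x, act (mul g h) x = act g (act h x)) /\
  (forall g x y, d (act g x) (act g y) = d x y).

(** proper action (Bridson-Haefliger I.8.2) *)
Definition proper_action (act : G -> X -> X) : Prop :=
  forall x, exists r, 0 < r /\ exists l : list G,
    forall g, (exists y, d x y < r /\ d x (act g y) < r) -> In g l.

Definition cocompact_action (act : G -> X -> X) : Prop :=
  exists K, compact d K /\ forall x, exists g y, K y /\ x = act g y.

Definition geometric_action mul e act : Prop :=
  isometric_action mul e act /\ proper_action act /\ cocompact_action act.

Definition limsupG (f : G -> R) : Rbar :=
  Rbar_glb (fun y => exists F : list G,
    y = Rbar_lub (fun z => exists g, ~ In g F /\ z = Finite (f g))).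

Definition liminfG (f : G -> R) : Rbar :=
  Rbar_lub (fun y => exists F : list G,
    y = Rbar_glb (fun z => exists g, ~ In g F /\ z = Finite (f g))).

Definition ray_act (act : G -> X -> X) (g : G) (r : R -> X) : R -> X :=
  fun t => act g (r t).

(** ∂X is a scrambled set (boundary points = rays up to asymptoticity) *)
Definition scrambled (act : G -> X -> X) (x0 : X) : Prop :=
  forall a b, is_ray d a -> is_ray d b -> ~ asymp d a b ->
    Rbar_lt (Finite 0)
      (limsupG (fun g => dbd d x0 (ray_act act g a) (ray_act act g b))) /\
    liminfG (fun g => dbd d x0 (ray_act act g a) (ray_act act g b)) = Finite 0.
End Group.

(* Main.v *)
(** liminf: the rays from [g_i x0] to the two boundary points [a], [b] both meet
    [B(y0, M)], so after applying [g_i^-1] the rays from [x0] to [g_i^-1 a] and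
    [g_i^-1 b] are still [2M]-close at a distance from [x0] tending to infinity,
    and convexity makes them close on every fixed initial segment.

    limsup: follow the ray [x0 a] to a far point [p], translated near [x0] by some
    [g]. Seen from [p], the rays to [a] and [b] diverge at a linear rate bounded
    below independently of [p] ([rays_diverge]), so at a fixed large time they
    stay apart even after moving the origin from [p] to the nearby orbit point.
    The rate replaces the Tits angle of [a] and [b]; Stewart's inequality
    is the only form of the CAT(0) condition that is needed. *)

Require Import Defs.
From Stdlib Require Import Reals List.
From Coquelicot Require Import Coquelicot.
From Stdlib Require Import Lra Lia ClassicalEpsilon Classical.
Open Scope R_scope.

(** * Segments and comparison triangles in the plane *)

(** The length is free and no endpoints are named, so geodesics, their reversals, initial pieces of
    rays and constant paths ([L = 0]) are all covered. *)
Definition segment {X : Type} (d : X -> X -> R) (c : R -> X) (L : R) : Prop :=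
  forall s t, 0 <= s <= L -> 0 <= t <= L -> d (c s) (c t) = Rabs (s - t).

Definition cauchy_complete {X : Type} (d : X -> X -> R) : Prop :=
  forall u : nat -> X,
    (forall eps, 0 < eps -> exists N, forall n, (N <= n)%nat -> d (u N) (u n) < eps) ->
    exists l, forall eps, 0 < eps -> exists N, forall n, (N <= n)%nat -> d (u n) l < eps.

Lemma eucl_eq (P Q : R * R) (r : R) :
  0 <= r -> (fst P - fst Q) ^ 2 + (snd P - snd Q) ^ 2 = r ^ 2 -> eucl P Q = r.
Proof.
  intros Hr H. unfold eucl. rewrite H.
  replace (r ^ 2) with (r * r) by ring. now apply sqrt_square.
Qed.

Lemma le_of_sq_le (x y : R) : 0 <= y -> x ^ 2 <= y ^ 2 -> x <= y.
Proof. intros Hy H. apply Rnot_lt_le. intros Hlt. nra. Qed.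

(** The side of length [b] lies on the first axis, and [x] is the abscissa of the apex by the law of
    cosines. The last clause is Stewart's theorem, through which the CAT(0) condition becomes
    algebraic. *)
Lemma comparison_triangle (a b c : R) :
  0 <= a -> 0 < b -> 0 <= c -> a <= b + c -> b <= a + c -> c <= a + b ->
  exists P : R * R,
    eucl P (0, 0) = a /\ eucl (b, 0) P = c /\
    forall u, (fst P - u) ^ 2 + (snd P) ^ 2
              = (1 - u / b) * a ^ 2 + u / b * c ^ 2 - u / b * (1 - u / b) * b ^ 2.
Proof.
  intros Ha Hb Hc H1 H2 H3.
  set (x := (a ^ 2 + b ^ 2 - c ^ 2) / (2 * b)).
  assert (Hx : 2 * b * x = a ^ 2 + b ^ 2 - c ^ 2) by (unfold x; field; lra).
  assert (Hle : x ^ 2 <= a ^ 2).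
  (* Heron's formula: both sides are sixteen times the squared area, and the triangle inequalities
     make the factors nonnegative. *)
  { assert (H : (2 * b) ^ 2 * (a ^ 2 - x ^ 2)
                = (c ^ 2 - (a - b) ^ 2) * ((a + b) ^ 2 - c ^ 2)).
    { replace ((2 * b) ^ 2 * (a ^ 2 - x ^ 2))
        with ((2 * b * a) ^ 2 - (2 * b * x) ^ 2) by ring.
      rewrite Hx. ring. }
    assert (0 <= c ^ 2 - (a - b) ^ 2).
    { replace (c ^ 2 - (a - b) ^ 2) with ((c - a + b) * (c + a - b)) by ring.
      apply Rmult_le_pos; lra. }
    assert (0 <= (a + b) ^ 2 - c ^ 2).
    { replace ((a + b) ^ 2 - c ^ 2) with ((a + b - c) * (a + b + c)) by ring.
      apply Rmult_le_pos; lra. }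
    assert (0 <= (2 * b) ^ 2 * (a ^ 2 - x ^ 2))
      by (rewrite H; now apply Rmult_le_pos).
    assert (0 < (2 * b) ^ 2) by (apply pow_lt; lra).
    nra. }
  assert (Hex : exists y, y ^ 2 = a ^ 2 - x ^ 2)
    by (exists (sqrt (a ^ 2 - x ^ 2)); apply pow2_sqrt; lra).
  destruct Hex as [y Hy].
  exists (x, y). split; [|split].
  - apply eucl_eq; cbn [fst snd]; lra.
  - apply eucl_eq; cbn [fst snd]; lra.
  - intros u. cbn [fst snd]. rewrite Hy. unfold x. field. lra.
Qed.

(** * Stewart's inequality and convexity of the distance *)

Section CAT0Geometry.
Context {X : Type} (d : X -> X -> R) (Hcat : CAT0 d).

Lemma dist_nonneg x y : 0 <= d x y.
Proof. apply Hcat. Qed.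

Lemma dist_refl x : d x x = 0.
Proof. now apply Hcat. Qed.

Lemma dist_eq0 x y : d x y = 0 -> x = y.
Proof. apply Hcat. Qed.

Lemma dist_sym x y : d x y = d y x.
Proof. apply Hcat. Qed.

Lemma dist_triangle y x z : d x z <= d x y + d y z.
Proof. apply Hcat. Qed.

Lemma segment_of_geodesic c x y : geodesic_from_to d c x y -> segment d c (d x y).
Proof. intros [_ [_ H]]. exact H. Qed.

Lemma segment_of_ray r L : is_ray d r -> segment d r L.
Proof. intros H s t Hs Ht. apply H; lra. Qed.

Lemma segment_length c L : 0 <= L -> segment d c L -> d (c 0) (c L) = L.
Proof.
  intros HL H. rewrite H by lra. rewrite Rabs_left1; lra.
Qed.

Lemma ray_length r t : 0 <= t -> is_ray d r -> d (r 0) (r t) = t.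
Proof. intros Ht H. apply segment_length; auto using segment_of_ray. Qed.

Lemma ray_shift r T : 0 <= T -> is_ray d r -> is_ray d (fun t => r (T + t)).
Proof.
  intros HT H s t Hs Ht. rewrite H by lra. f_equal. ring.
Qed.

Lemma segment_rev c L : segment d c L -> segment d (fun t => c (L - t)) L.
Proof.
  intros H s t Hs Ht. rewrite H by lra.
  replace (L - s - (L - t)) with (- (s - t)) by ring. apply Rabs_Ropp.
Qed.

(** Equality holds in the comparison triangle of [p], [c 0], [c L]; the CAT(0) inequality is applied
    to the vertex [p] and the point [c (lam * L)]. *)
Lemma stewart c L p lam :
  0 <= L -> segment d c L -> 0 <= lam <= 1 ->
  d p (c (lam * L)) ^ 2
  <= (1 - lam) * d p (c 0) ^ 2 + lam * d p (c L) ^ 2 - lam * (1 - lam) * L ^ 2.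
Proof.
  intros HL Hc Hlam.
  destruct (Rle_lt_or_eq_dec 0 L HL) as [HL0|HL0].
  2:{ subst L. rewrite Rmult_0_r. nra. }
  pose proof (segment_length c L HL Hc) as Hlen.
  assert (Hg : geodesic_from_to d c (c 0) (c L)).
  { unfold geodesic_from_to. rewrite Hlen. repeat split. exact Hc. }
  destruct Hcat as [_ [Hgeo Hcomp]].
  destruct (Hgeo p (c 0)) as [c1 Hc1].
  destruct (Hgeo (c L) p) as [c3 Hc3].
  destruct (comparison_triangle (d p (c 0)) L (d (c L) p)) as [P [HPQ [HRP HP]]].
  - apply dist_nonneg.
  - lra.
  - apply dist_nonneg.
  - pose proof (dist_triangle (c L) p (c 0)). rewrite (dist_sym (c L) p).
    rewrite (dist_sym (c L) (c 0)) in H. lra.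
  - pose proof (dist_triangle p (c 0) (c L)).
    rewrite (dist_sym (c L) p), (dist_sym p (c 0)). lra.
  - pose proof (dist_triangle (c 0) p (c L)). rewrite (dist_sym (c L) p). lra.
  - assert (HQR : eucl (0, 0) (L, 0) = d (c 0) (c L)).
    { rewrite Hlen. apply eucl_eq; simpl; [lra|ring]. }
    pose proof (Hcomp p (c 0) (c L) c1 c c3 P (0, 0) (L, 0) Hc1 Hg Hc3 HPQ HQR HRP)
      as Hs.
    simpl in Hs.
    specialize (Hs (c1, d p (c 0), P, (0, 0)) (c, d (c 0) (c L), (0, 0), (L, 0))
                  (or_introl eq_refl) (or_intror (or_introl eq_refl))).
    simpl in Hs. rewrite Hlen in Hs.
    specialize (Hs 0 (lam * L) P (lam * L, 0)).
    assert (HlL : 0 <= lam * L <= L) by nra.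
    assert (Hd : d (c1 0) (c (lam * L)) <= eucl P (lam * L, 0)).
    { apply Hs.
      - split; [lra|apply dist_nonneg].
      - exact HlL.
      - apply eucl_eq; [lra|ring].
      - lra.
      - apply eucl_eq; simpl; [lra|ring].
      - apply eucl_eq; simpl; [lra|ring]. }
    destruct Hc1 as [Hc10 _]. rewrite Hc10 in Hd.
    specialize (HP (lam * L)).
    replace (lam * L / L) with lam in HP by (field; lra).
    rewrite (dist_sym (c L) p) in HP. rewrite <- HP.
    assert (Hsq : eucl P (lam * L, 0) ^ 2 = (fst P - lam * L) ^ 2 + snd P ^ 2).
    { unfold eucl. rewrite pow2_sqrt.
      - simpl. ring.
      - apply Rplus_le_le_0_compat; apply pow2_ge_0. }
    rewrite <- Hsq. apply pow_incr. split; [apply dist_nonneg|exact Hd].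
Qed.

(* The law of cosines in the comparison triangle: two applications of Stewart. *)
Lemma hinge c c' a b lam mu :
  0 <= a -> 0 <= b -> segment d c a -> segment d c' b -> c 0 = c' 0 ->
  0 <= lam <= 1 -> 0 <= mu <= 1 ->
  d (c (lam * a)) (c' (mu * b)) ^ 2
  <= (lam * a) ^ 2 + (mu * b) ^ 2 + lam * mu * (d (c a) (c' b) ^ 2 - a ^ 2 - b ^ 2).
Proof.
  intros Ha Hb Hc Hc' H0 Hlam Hmu.
  pose proof (stewart c' b (c (lam * a)) mu Hb Hc' Hmu) as H1.
  pose proof (stewart c a (c' b) lam Ha Hc Hlam) as H2.
  assert (E1 : d (c (lam * a)) (c' 0) = lam * a).
  { rewrite <- H0, Hc by nra. rewrite Rabs_pos_eq; nra. }
  assert (E2 : d (c' b) (c 0) = b).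
  { rewrite H0, dist_sym. now apply segment_length. }
  rewrite E1 in H1. rewrite E2 in H2.
  rewrite (dist_sym (c' b)) in H2. rewrite (dist_sym (c' b)) in H2.
  assert (mu * d (c (lam * a)) (c' b) ^ 2
          <= mu * ((1 - lam) * b ^ 2 + lam * d (c a) (c' b) ^ 2
                   - lam * (1 - lam) * a ^ 2))
    by (apply Rmult_le_compat_l; lra).
  lra.
Qed.

(** With [mu = lam] in [hinge] the terms in [a] and [b] cancel and a square remains. *)
Lemma cone_convexity c c' a b lam :
  0 <= a -> 0 <= b -> segment d c a -> segment d c' b -> c 0 = c' 0 ->
  0 <= lam <= 1 -> d (c (lam * a)) (c' (lam * b)) <= lam * d (c a) (c' b).
Proof.
  intros Ha Hb Hc Hc' H0 Hlam.
  pose proof (hinge c c' a b lam lam Ha Hb Hc Hc' H0 Hlam Hlam) as H.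
  apply le_of_sq_le.
  - apply Rmult_le_pos; [lra|apply dist_nonneg].
  - eapply Rle_trans; [exact H|]. right. ring.
Qed.

(** The diagonal [g] from [c 0] to [c' b] cuts the quadrilateral into two triangles.
    [cone_convexity] applies at [c 0] to one and, after reversal, at [c' b] to the other. *)
Lemma dist_convexity c c' a b lam :
  0 <= a -> 0 <= b -> segment d c a -> segment d c' b -> 0 <= lam <= 1 ->
  d (c (lam * a)) (c' (lam * b)) <= (1 - lam) * d (c 0) (c' 0) + lam * d (c a) (c' b).
Proof.
  intros Ha Hb Hc Hc' Hlam.
  destruct Hcat as [_ [Hgeo _]].
  destruct (Hgeo (c 0) (c' b)) as [g Hg].
  set (L := d (c 0) (c' b)) in *.
  assert (HL : 0 <= L) by apply dist_nonneg.
  pose proof (segment_of_geodesic _ _ _ Hg) as Hgs. fold L in Hgs.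
  destruct Hg as [Hg0 [HgL _]]. fold L in HgL.
  pose proof (cone_convexity c g a L lam Ha HL Hc Hgs (eq_sym Hg0) Hlam) as H1.
  assert (Hlam' : 0 <= 1 - lam <= 1) by lra.
  pose proof (cone_convexity _ _ L b (1 - lam) HL Hb (segment_rev g L Hgs)
                (segment_rev c' b Hc')) as H2.
  cbv beta in H2. rewrite !Rminus_0_r in H2. specialize (H2 HgL Hlam').
  replace (L - (1 - lam) * L) with (lam * L) in H2 by ring.
  replace (b - (1 - lam) * b) with (lam * b) in H2 by ring.
  rewrite !Rminus_diag, Hg0 in H2. rewrite HgL in H1.
  pose proof (dist_triangle (g (lam * L)) (c (lam * a)) (c' (lam * b))). lra.
Qed.

(** * Asymptotic rays *)

Lemma asymp_sym a b : asymp d a b -> asymp d b a.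
Proof. intros [C H]. exists C. intros t Ht. rewrite dist_sym. auto. Qed.

Lemma asymp_trans b a c : asymp d a b -> asymp d b c -> asymp d a c.
Proof.
  intros [C H] [C' H']. exists (C + C'). intros t Ht.
  pose proof (dist_triangle (b t) (a t) (c t)).
  specialize (H t Ht). specialize (H' t Ht). lra.
Qed.

(** A bounded convex function on a half-line never exceeds its initial value. *)
Lemma asymp_dist_le r r' t :
  is_ray d r -> is_ray d r' -> asymp d r r' -> 0 <= t -> d (r t) (r' t) <= d (r 0) (r' 0).
Proof.
  intros Hr Hr' [C HC] Ht. apply Rnot_lt_le. intros Hlt.
  set (D := d (r t) (r' t)) in *. set (D0 := d (r 0) (r' 0)) in *.
  assert (HD0 : 0 <= D0) by apply dist_nonneg.
  assert (Ht0 : 0 < t).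
  { destruct Ht as [Ht|Ht]; [exact Ht|]. exfalso. unfold D, D0 in Hlt. subst t. lra. }
  (* Time [t] is compared with [t / lam]; this [lam] makes the contribution of the bound [C] less
     than half of the gap [D - D0]. *)
  set (lam := Rmin 1 ((D - D0) / (2 * (Rabs C + 1)))).
  assert (HA : 0 <= Rabs C) by apply Rabs_pos.
  assert (Hq : 0 < (D - D0) / (2 * (Rabs C + 1))) by (apply Rdiv_lt_0_compat; lra).
  assert (Hl0 : 0 < lam) by (apply Rmin_pos; lra).
  assert (Hl1 : lam <= 1) by apply Rmin_l.
  assert (Hl2 : lam * (2 * (Rabs C + 1)) <= D - D0).
  { apply Rle_trans with ((D - D0) / (2 * (Rabs C + 1)) * (2 * (Rabs C + 1))).
    - apply Rmult_le_compat_r; [lra|apply Rmin_r].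
    - right. field. lra. }
  assert (HT : 0 <= t / lam) by (apply Rlt_le, Rdiv_lt_0_compat; lra).
  pose proof (dist_convexity r r' (t / lam) (t / lam) lam HT HT
    (segment_of_ray r _ Hr) (segment_of_ray r' _ Hr') ltac:(lra)) as H.
  replace (lam * (t / lam)) with t in H by (field; lra). fold D D0 in H.
  specialize (HC (t / lam) HT). pose proof (Rle_abs C). nra.
Qed.

Lemma asymp_unique r r' t :
  is_ray d r -> is_ray d r' -> asymp d r r' -> r 0 = r' 0 -> 0 <= t -> r t = r' t.
Proof.
  intros Hr Hr' H H0 Ht. apply dist_eq0.
  pose proof (asymp_dist_le r r' t Hr Hr' H Ht) as Hd.
  rewrite H0, dist_refl in Hd. pose proof (dist_nonneg (r t) (r' t)). lra.
Qed.

(** * Completeness from a geometric action *)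

(** Without a cluster point, every point has a ball that the sequence avoids from some index on;
    finitely many such balls cover [K], and a late term lies in none of them. *)
Lemma compact_cluster_point K (k : nat -> X) :
  Defs.compact d K -> (forall n, K (k n)) ->
  exists x, forall eps N, 0 < eps -> exists n, (N <= n)%nat /\ d (k n) x < eps.
Proof.
  intros HK Hk. apply NNPP. intros Hno.
  (* The cover is indexed by all triples of centre, radius and index. A triple whose ball is not
     avoided gives the empty set, so every member is open. *)
  destruct (HK (X * R * nat)%type
    (fun i y => d (fst (fst i)) y < snd (fst i) /\
       forall n, (snd i <= n)%nat -> snd (fst i) <= d (k n) (fst (fst i)))) as [l Hl].
  - intros [[x r] N] y [Hy HN]; cbn [fst snd] in *.
    exists (r - d x y). split; [lra|]. intros z Hz. split; [|exact HN].
    pose proof (dist_triangle y x z). lra.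
  - intros x _. apply NNPP. intros Hx. apply Hno. exists x. intros eps N Heps.
    apply NNPP. intros HN. apply Hx. exists (x, eps, N). cbn [fst snd].
    rewrite dist_refl. split; [exact Heps|]. intros n Hn.
    apply Rnot_lt_le. intros Hlt. apply HN. now exists n.
  - set (N := list_max (map snd l)).
    destruct (Hl (k N) (Hk N)) as [i [Hi [H1 H2]]].
    assert (HiN : (snd i <= N)%nat).
    { pose proof (proj1 (list_max_le (map snd l) N) (le_n _)) as HF.
      rewrite Forall_forall in HF. apply HF. now apply in_map. }
    specialize (H2 N HiN). rewrite dist_sym in H2. lra.
Qed.

Lemma compact_bounded K x :
  Defs.compact d K -> exists D, 0 <= D /\ forall y, K y -> d x y <= D.
Proof.
  intros HK. destruct (HK nat (fun n y => d x y < INR n)) as [l Hl].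
  - intros n y Hy. exists (INR n - d x y). split; [lra|]. intros z Hz.
    pose proof (dist_triangle y x z). lra.
  - intros y _. destruct (INR_unbounded (d x y)) as [n Hn]. exists n. lra.
  - exists (INR (list_max l)). split; [apply pos_INR|]. intros y Hy.
    destruct (Hl y Hy) as [n [Hn H]].
    pose proof (proj1 (list_max_le l _) (le_n _)) as HF.
    rewrite Forall_forall in HF. specialize (HF n Hn). apply le_INR in HF. lra.
Qed.

Lemma list_pigeonhole {A : Type} (l : list A) (P : A -> R -> nat -> Prop) :
  (forall a eps eps' N N', P a eps N -> eps <= eps' -> (N' <= N)%nat -> P a eps' N') ->
  (forall eps N, 0 < eps -> exists a, In a l /\ P a eps N) ->
  exists a, forall eps N, 0 < eps -> P a eps N.
Proof.
  intros Hmono. induction l as [|b l IH]; intros H.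
  - destruct (H 1 0%nat Rlt_0_1) as [a [[] _]].
  - destruct (classic (forall eps N, 0 < eps -> P b eps N)) as [Hb|Hb]; [now exists b|].
    apply IH. intros eps N Heps.
    assert (Hex : exists eps0 N0, 0 < eps0 /\ ~ P b eps0 N0).
    { apply NNPP. intros Hn. apply Hb. intros eps0 N0 H0. apply NNPP. intros HP.
      apply Hn. now exists eps0, N0. }
    destruct Hex as [eps0 [N0 [H0 HP]]].
    destruct (H (Rmin eps eps0) (max N N0) (Rmin_pos _ _ Heps H0)) as [a [[->|Ha] Hpa]].
    + exfalso. apply HP. eapply Hmono; [exact Hpa|apply Rmin_r|lia].
    + exists a. split; [exact Ha|].
      eapply Hmono; [exact Hpa|apply Rmin_l|lia].
Qed.

(* Write [u n = g_n k_n] with [k_n] in a compact fundamental domain, and let [k] be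
   a cluster point of [k_n]. Along indices where [k_n] is close to [k], the points
   [g_n k] are close to each other, so properness at [k] leaves finitely many
   [g_n], and one of them, say [g], has [g k] as a cluster point of [u]. *)
Lemma geometric_complete {G : Type} (mul : G -> G -> G) e inv act :
  is_group mul e inv -> geometric_action d mul e act -> cauchy_complete d.
Proof.
  intros [Hassoc [He Hinv]] [[Hact1 [Hactm Hiso]] [Hprop [K [HK Hcov]]]] u Hu.
  assert (Hcov' : forall n, exists p : G * X, K (snd p) /\ u n = act (fst p) (snd p)).
  { intros n. destruct (Hcov (u n)) as [g [y Hy]]. now exists (g, y). }
  set (f n := proj1_sig (constructive_indefinite_description _ (Hcov' n))).
  assert (Hf : forall n, K (snd (f n)) /\ u n = act (fst (f n)) (snd (f n)))
    by (intros n; apply (proj2_sig (constructive_indefinite_description _ (Hcov' n)))).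
  destruct (compact_cluster_point K (fun n => snd (f n)) HK (fun n => proj1 (Hf n)))
    as [k Hk].
  destruct (Hprop k) as [r [Hr [l Hl]]].
  destruct (Hu (r / 4) ltac:(lra)) as [N0 HN0].
  destruct (Hk (r / 4) N0 ltac:(lra)) as [n0 [Hn0 Hkn0]].
  set (g0 := fst (f n0)).
  assert (Hclose : forall n, d (u n) (act (fst (f n)) k) = d (snd (f n)) k).
  { intros n. rewrite (proj2 (Hf n)) at 1. apply Hiso. }
  destruct (list_pigeonhole l (fun h eps N =>
     exists n, (N <= n)%nat /\ mul (inv g0) (fst (f n)) = h /\ d (snd (f n)) k < eps))
    as [h Hh].
  - intros a eps eps' N N' [n [H1 [H2 H3]]] Hle HN. exists n.
    repeat split; [lia|exact H2|lra].
  - intros eps N Heps.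
    destruct (Hk (Rmin eps (r / 4)) (max N N0)) as [n [Hn Hkn]].
    { apply Rmin_pos; lra. }
    pose proof (Rmin_l eps (r / 4)). pose proof (Rmin_r eps (r / 4)).
    exists (mul (inv g0) (fst (f n))). split.
    2:{ exists n. repeat split; [lia|lra]. }
    (* Properness is tested at [k] itself: the path from [g0 k] to [g_n k] through [u n0], [u N0]
       and [u n] has four steps shorter than [r / 4]. *)
    apply Hl. exists k. split; [rewrite dist_refl; lra|].
    rewrite <- (Hiso g0), <- Hactm, Hassoc, (proj2 (Hinv g0)), (proj1 (He _)).
    pose proof (Hclose n) as C1. pose proof (Hclose n0) as C0. fold g0 in C0.
    pose proof (HN0 n ltac:(lia)) as C2. pose proof (HN0 n0 ltac:(lia)) as C3.
    pose proof (dist_triangle (u n0) (act g0 k) (act (fst (f n)) k)) as T1.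
    pose proof (dist_triangle (u N0) (u n0) (act (fst (f n)) k)) as T2.
    pose proof (dist_triangle (u n) (u N0) (act (fst (f n)) k)) as T3.
    rewrite (dist_sym (act g0 k) (u n0)) in T1. rewrite (dist_sym (u n0) (u N0)) in T2.
    lra.
  - assert (Hgh : forall n, mul (inv g0) (fst (f n)) = h -> fst (f n) = mul g0 h).
    { intros n <-. now rewrite Hassoc, (proj2 (Hinv g0)), (proj1 (He _)). }
    exists (act (mul g0 h) k). intros eps Heps.
    destruct (Hu (eps / 3) ltac:(lra)) as [N HN].
    destruct (Hh (eps / 3) N ltac:(lra)) as [m [Hm [Hgm Hkm]]].
    exists N. intros n Hn. apply Hgh in Hgm. rewrite <- Hgm.
    rewrite <- Hclose in Hkm.
    pose proof (HN n Hn) as C1. pose proof (HN m Hm) as C2.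
    pose proof (dist_triangle (u N) (u n) (act (fst (f m)) k)) as T1.
    pose proof (dist_triangle (u m) (u N) (act (fst (f m)) k)) as T2.
    rewrite (dist_sym (u n) (u N)) in T1. lra.
Qed.

(** * Existence of a ray from a given point *)

Lemma hinge_same_time c c' a b t :
  0 < a -> 0 < b -> segment d c a -> segment d c' b -> c 0 = c' 0 ->
  0 <= t <= a -> t <= b ->
  d (c t) (c' t) ^ 2 <= t ^ 2 / (a * b) * (d (c a) (c' b) ^ 2 - (a - b) ^ 2).
Proof.
  intros Ha Hb Hc Hc' H0 Hta Htb.
  assert (E1 : t / a * a = t) by (field; lra).
  assert (E2 : t / b * b = t) by (field; lra).
  assert (L1 : 0 <= t / a <= 1).
  { split; [apply Rdiv_le_0_compat; lra|]. apply Rle_div_l; lra. }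
  assert (L2 : 0 <= t / b <= 1).
  { split; [apply Rdiv_le_0_compat; lra|]. apply Rle_div_l; lra. }
  pose proof (hinge c c' a b _ _ (Rlt_le _ _ Ha) (Rlt_le _ _ Hb) Hc Hc' H0 L1 L2) as H.
  rewrite E1, E2 in H. eapply Rle_trans; [exact H|]. right. field. lra.
Qed.

(** The lengths [p] and [q] differ from [n] and [m] by at most [D]. Hence the excess in
    [hinge_same_time] is at most [4 * D * m], while [p * q] is at least [n * m / 4], and [m]
    cancels. *)
Lemma geodesics_to_ray_cauchy b x c c' n m t D :
  is_ray d b -> d x (b 0) <= D -> 0 < n -> n <= m -> 2 * D <= n -> 2 * t <= n -> 0 <= t ->
  geodesic_from_to d c x (b n) -> geodesic_from_to d c' x (b m) ->
  d (c t) (c' t) ^ 2 <= 16 * D * t ^ 2 / n.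
Proof.
  intros Hb HD Hn Hnm HDn Htn Ht Hc Hc'.
  pose proof (dist_nonneg x (b 0)) as HD0.
  assert (Hlen : forall s, 0 <= s -> s - D <= d x (b s) <= s + D).
  { intros s Hs. pose proof (ray_length b s Hs Hb).
    pose proof (dist_triangle (b 0) x (b s)).
    pose proof (dist_triangle x (b 0) (b s)). rewrite (dist_sym (b 0) x) in H1. lra. }
  pose proof (Hlen n ltac:(lra)) as Ln. pose proof (Hlen m ltac:(lra)) as Lm.
  pose proof (segment_of_geodesic _ _ _ Hc) as Sc.
  pose proof (segment_of_geodesic _ _ _ Hc') as Sc'.
  destruct Hc as [Hc0 [Hc1 _]]. destruct Hc' as [Hc0' [Hc1' _]].
  set (p := d x (b n)) in *. set (q := d x (b m)) in *.
  pose proof (hinge_same_time c c' p q t ltac:(lra) ltac:(lra) Sc Sc'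
    ltac:(congruence) ltac:(lra) ltac:(lra)) as H.
  rewrite Hc1, Hc1' in H.
  assert (Hmn : d (b n) (b m) = m - n).
  { rewrite Hb by lra. rewrite Rabs_left1; lra. }
  rewrite Hmn in H.
  assert (Hpq : 0 < p * q) by (apply Rmult_lt_0_compat; lra).
  eapply Rle_trans; [exact H|].
  assert (N1 : (m - n) ^ 2 - (p - q) ^ 2 <= 4 * D * m).
  { replace ((m - n) ^ 2 - (p - q) ^ 2)
      with ((m - n - (q - p)) * (m - n + (q - p))) by ring.
    assert (q - p <= m - n).
    { pose proof (dist_triangle (b n) x (b m)). rewrite Hmn in H0. fold p q in H0. lra. }
    assert (p - q <= m - n).
    { pose proof (dist_triangle (b m) x (b n)) as T. rewrite (dist_sym (b m)), Hmn in T.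
      fold p q in T. lra. }
    replace (4 * D * m) with ((2 * D) * (2 * m)) by ring.
    apply Rmult_le_compat; lra. }
  assert (N2 : n * m <= 4 * (p * q)).
  { replace (4 * (p * q)) with ((2 * p) * (2 * q)) by ring.
    apply Rmult_le_compat; lra. }
  assert (T2 : 0 <= t ^ 2) by apply pow2_ge_0.
  apply Rle_trans with (t ^ 2 / (p * q) * (4 * D * m)).
  { apply Rmult_le_compat_l; [|exact N1].
    apply Rdiv_le_0_compat; [exact T2|exact Hpq]. }
  apply (proj1 (Rle_div_r _ _ n Hn)).
  replace (t ^ 2 / (p * q) * (4 * D * m) * n) with ((4 * D * t ^ 2) * (n * m) / (p * q))
    by (field; split; lra).
  apply Rle_div_l; [exact Hpq|].
  replace (16 * D * t ^ 2 * (p * q)) with (4 * D * t ^ 2 * (4 * (p * q))) by ring.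
  apply Rmult_le_compat_l; [|exact N2].
  apply Rmult_le_pos; [lra|exact T2].
Qed.

Lemma INR_large A : exists n, forall m, (n <= m)%nat -> A < INR m.
Proof.
  destruct (INR_unbounded A) as [n Hn]. exists n. intros m Hm.
  apply le_INR in Hm. lra.
Qed.

(** The ray is the pointwise limit of the geodesics [c n] from [x] to [b (INR n)]. *)
Lemma ray_exists b x :
  cauchy_complete d -> is_ray d b -> exists r, is_ray d r /\ r 0 = x /\ asymp d b r.
Proof.
  intros Hcomp Hb.
  assert (Hgeo : forall n : nat, exists c, geodesic_from_to d c x (b (INR n)))
    by (intros n; apply Hcat).
  set (c n := proj1_sig (constructive_indefinite_description _ (Hgeo n))).
  assert (Hc : forall n, geodesic_from_to d (c n) x (b (INR n)))
    by (intros n; apply (proj2_sig (constructive_indefinite_description _ (Hgeo n)))).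
  set (D := d x (b 0)). pose proof (dist_nonneg x (b 0)) as HD. fold D in HD.
  (* The condition [0 <= t] stands inside the existential, so that choice yields a total function,
     arbitrary at negative times. *)
  assert (Hlim : forall t, exists y, 0 <= t ->
     forall eps, 0 < eps -> exists N, forall n, (N <= n)%nat -> d (c n t) y < eps).
  { intros t. destruct (Rle_dec 0 t) as [Ht|Ht].
    2:{ exists x. intros Ht'. contradiction. }
    destruct (Hcomp (fun n => c n t)) as [y Hy]; [|now exists y].
    intros eps Heps.
    (* The first terms secure the side conditions of [geodesics_to_ray_cauchy]; the last pushes its
       bound below [eps ^ 2]. *)
    destruct (INR_large (1 + 2 * D + 2 * t + 16 * D * t ^ 2 / eps ^ 2)) as [N HN].
    exists N. intros n Hn. pose proof (HN N (le_n _)) as HNN.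
    assert (Heps2 : 0 < eps ^ 2) by (apply pow_lt; lra).
    assert (Hq : 0 <= 16 * D * t ^ 2 / eps ^ 2).
    { apply Rdiv_le_0_compat; [|lra]. apply Rmult_le_pos; [lra|apply pow2_ge_0]. }
    pose proof (geodesics_to_ray_cauchy b x (c N) (c n) (INR N) (INR n) t D Hb
      (Rle_refl _) ltac:(lra) (le_INR _ _ Hn) ltac:(lra) ltac:(lra) Ht (Hc N) (Hc n)) as H.
    apply Rnot_le_lt. intros Hle.
    assert (H' : eps ^ 2 <= 16 * D * t ^ 2 / INR N).
    { eapply Rle_trans; [|exact H]. apply pow_incr. lra. }
    apply Rle_div_r in H'; [|lra].
    assert (16 * D * t ^ 2 / eps ^ 2 < INR N) by lra.
    apply Rlt_div_l in H0; [|lra]. lra. }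
  set (r t := proj1_sig (constructive_indefinite_description _ (Hlim t))).
  assert (Hr : forall t, 0 <= t -> forall eps, 0 < eps ->
     exists N, forall n, (N <= n)%nat -> d (c n t) (r t) < eps)
    by (intros t; apply (proj2_sig (constructive_indefinite_description _ (Hlim t)))).
  assert (Hlen : forall n, Rabs (d x (b (INR n)) - INR n) <= D).
  { intros n. pose proof (ray_length b (INR n) (pos_INR n) Hb) as E.
    pose proof (dist_triangle (b 0) x (b (INR n))).
    pose proof (dist_triangle x (b 0) (b (INR n))). rewrite (dist_sym (b 0) x) in H0.
    fold D in H, H0. apply Rabs_le. lra. }
  assert (Happrox : forall t T eps, 0 <= t -> 0 < eps ->
     exists n, T < INR n /\ t <= d x (b (INR n)) /\ d (c n t) (r t) < eps).
  { intros t T eps Ht Heps. destruct (Hr t Ht eps Heps) as [N HN].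
    destruct (INR_large (Rmax T (t + D))) as [N' HN'].
    exists (max N N'). specialize (HN' (max N N') ltac:(lia)).
    pose proof (Rmax_l T (t + D)). pose proof (Rmax_r T (t + D)).
    pose proof (proj1 (proj1 (Rabs_le_between _ _) (Hlen (max N N')))).
    repeat split; [lra|lra|]. apply HN. lia. }
  exists r. split; [|split].
  - intros s t Hs Ht.
    assert (Hdiff : forall eps, 0 < eps -> Rabs (d (r s) (r t) - Rabs (s - t)) <= 2 * eps).
    { intros eps Heps. destruct (Hr s Hs eps Heps) as [N HN].
      destruct (Hr t Ht eps Heps) as [N' HN'].
      destruct (INR_large (s + t + D)) as [N'' HN''].
      set (n := max N (max N' N'')).
      specialize (HN n ltac:(lia)). specialize (HN' n ltac:(lia)).
      specialize (HN'' n ltac:(lia)).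
      pose proof (proj1 (proj1 (Rabs_le_between _ _) (Hlen n))) as HL.
      destruct (Hc n) as [_ [_ Hseg]].
      rewrite <- (Hseg s t) by lra.
      pose proof (dist_triangle (c n s) (r s) (r t)).
      pose proof (dist_triangle (c n t) (c n s) (r t)).
      pose proof (dist_triangle (r s) (c n s) (c n t)).
      pose proof (dist_triangle (r t) (r s) (c n t)).
      rewrite (dist_sym (r s) (c n s)) in H. rewrite (dist_sym (r t) (c n t)) in H2.
      apply Rabs_le. lra. }
    apply Rminus_diag_uniq. apply cond_eq. intros eps Heps. rewrite Rminus_0_r.
    eapply Rle_lt_trans; [apply (Hdiff (eps / 4)); lra|lra].
  - apply dist_eq0. apply Rle_antisym; [|apply dist_nonneg].
    apply le_epsilon. intros eps Heps.
    destruct (Happrox 0 0 eps (Rle_refl _) Heps) as [n [_ [_ Hn]]].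
    rewrite (proj1 (Hc n)), dist_sym in Hn. lra.
  - exists (2 * D). intros t Ht. apply le_epsilon. intros eps Heps.
    destruct (Happrox t (t + 1) eps Ht Heps) as [n [Hn [HtL Hd]]].
    pose proof (segment_of_geodesic _ _ _ (Hc n)) as Sc.
    destruct (Hc n) as [Hc0 [Hc1 _]]. specialize (Hlen n).
    set (L := d x (b (INR n))) in *.
    assert (HL : 0 <= L) by apply dist_nonneg.
    destruct (Rle_lt_or_eq_dec 0 t Ht) as [Ht0|Ht0].
    2:{ subst t. rewrite Hc0 in Hd. pose proof (dist_triangle x (b 0) (r 0)).
        rewrite (dist_sym (b 0) x) in H. fold D in H. lra. }
    assert (Hlam : 0 <= t / L <= 1).
    { split; [apply Rdiv_le_0_compat; lra|]. apply Rle_div_l; lra. }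
    pose proof (dist_convexity (c n) b L (INR n) (t / L) HL (pos_INR n) Sc
      (segment_of_ray b _ Hb) Hlam) as H.
    rewrite Hc0, Hc1, dist_refl in H. fold D in H.
    replace (t / L * L) with t in H by (field; lra).
    (* At proportional times [c n] and [b] are at most [(1 - t / L) * D] apart; correcting the time
       on [b] costs [t / L * D]. *)
    assert (Hmove : d (b (t / L * INR n)) (b t) <= t / L * D).
    { rewrite Hb; [|apply Rmult_le_pos; [lra|apply pos_INR]|lra].
      replace (t / L * INR n - t) with (t / L * - (L - INR n)) by (field; lra).
      rewrite Rabs_mult, Rabs_Ropp, Rabs_pos_eq by lra.
      apply Rmult_le_compat_l; lra. }
    pose proof (dist_triangle (c n t) (b t) (r t)).
    pose proof (dist_triangle (b (t / L * INR n)) (c n t) (b t)).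
    rewrite (dist_sym (b t) (c n t)) in H0. lra.
Qed.

(** * Divergence of rays *)

(** A finite form of the fact that the Busemann function of [b] drops at unit speed along [eta]. In
    Stewart's inequality for [b s], the side from [b s] to [eta s] stays bounded while [s] grows. *)
Lemma dist_to_far_point eta b j eps :
  is_ray d eta -> is_ray d b -> asymp d b eta -> 0 <= j -> 0 < eps ->
  exists S, forall s, S <= s -> d (eta j) (b s) <= d (eta 0) (b s) - j + eps.
Proof.
  intros He Hb [C HC] Hj Heps.
  assert (Heps2 : 0 < eps ^ 2) by (apply pow_lt; lra).
  assert (HC0 : 0 <= C)
    by (eapply Rle_trans; [apply (dist_nonneg (b 0) (eta 0))|apply HC; lra]).
  assert (HQ : 0 <= j * C ^ 2 / eps ^ 2).
  { apply Rdiv_le_0_compat; [|exact Heps2].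
    apply Rmult_le_pos; [lra|apply pow2_ge_0]. }
  (* The part [1 + C + j] gives [D >= j]; the last term gives [j * C ^ 2 / s <= eps ^ 2]. *)
  exists (1 + C + j + j * C ^ 2 / eps ^ 2). intros s Hs.
  set (D := d (eta 0) (b s)).
  assert (Hs0 : 0 < s) by lra.
  pose proof (ray_length eta s (Rlt_le _ _ Hs0) He) as Hlen.
  specialize (HC s (Rlt_le _ _ Hs0)).
  assert (HD : s - C <= D).
  { pose proof (dist_triangle (b s) (eta 0) (eta s)). fold D in H. lra. }
  assert (Hlam : 0 <= j / s <= 1).
  { split; [apply Rdiv_le_0_compat; lra|]. apply Rle_div_l; lra. }
  pose proof (stewart eta s (b s) (j / s) (Rlt_le _ _ Hs0) (segment_of_ray _ _ He) Hlam)
    as H.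
  replace (j / s * s) with j in H by (field; lra).
  rewrite (dist_sym (b s) (eta 0)), (dist_sym (b s) (eta j)) in H. fold D in H.
  apply le_of_sq_le; [lra|].
  assert (HjC : j / s * C ^ 2 <= eps ^ 2).
  { replace (j / s * C ^ 2) with (j * C ^ 2 / s) by (field; lra).
    apply Rle_div_l; [lra|].
    assert (Hq : j * C ^ 2 / eps ^ 2 <= s) by lra.
    apply Rle_div_l in Hq; [lra|exact Heps2]. }
  assert (Hbs : j / s * d (b s) (eta s) ^ 2 <= j / s * C ^ 2).
  { apply Rmult_le_compat_l; [lra|]. apply pow_incr. split; [apply dist_nonneg|exact HC]. }
  assert (E : (1 - j / s) * D ^ 2 - j / s * (1 - j / s) * s ^ 2
              = (D - j) ^ 2 - j / s * (D - s) ^ 2) by (field; lra).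
  assert (0 <= j / s * (D - s) ^ 2) by (apply Rmult_le_pos; [lra|apply pow2_ge_0]).
  assert (0 <= eps * (D - j)) by (apply Rmult_le_pos; lra).
  replace ((D - j + eps) ^ 2) with ((D - j) ^ 2 + 2 * (eps * (D - j)) + eps ^ 2) by ring.
  lra.
Qed.

(* If the ray [eta] from [a T] towards [b] stayed close to [a] for time [j], the
   distance to a far point [b s] would decrease along [a] with slope almost [-1]
   on [[T, T + j]], hence by convexity also on [[0, t0]]; then the triangle
   [a 0, a t0, b s] is nearly degenerate and [a t0] is too close to [b t0]. *)
Lemma rays_diverge a b eta t0 T j :
  is_ray d a -> is_ray d b -> a 0 = b 0 -> 0 < t0 <= T -> 0 < j ->
  is_ray d eta -> eta 0 = a T -> asymp d b eta ->
  d (a t0) (b t0) ^ 2 / (4 * t0 ^ 2) * j <= d (eta j) (a (T + j)).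
Proof.
  intros Ha Hb H0 Ht0 Hj He He0 Hbe. apply Rnot_lt_le. intros Hlt.
  set (c := d (a t0) (b t0)) in *. set (k := c ^ 2 / (4 * t0 ^ 2)) in *.
  set (del := d (eta j) (a (T + j))) in *.
  assert (Ht2 : 0 < t0 ^ 2) by (apply pow_lt; lra).
  assert (Hdel : 0 <= del) by apply dist_nonneg.
  assert (Hk : 0 < k) by nra.
  assert (Hc2 : c ^ 2 = 4 * t0 ^ 2 * k) by (unfold k; field; lra).
  (* The tolerance is positive by [Hlt], and adding [del] back in [A1] makes the total loss
     [k * j]. *)
  destruct (dist_to_far_point eta b j (k * j - del) He Hb Hbe) as [S HS]; [lra|lra|].
  (* Stewart's inequality requires [t0 <= s]; [t0 * k <= s] absorbs the quadratic term in [H2]. *)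
  set (s := Rmax S (t0 + t0 * k)).
  assert (Hs1 : S <= s) by apply Rmax_l.
  assert (Hs2 : t0 + t0 * k <= s) by apply Rmax_r.
  assert (Htk : 0 < t0 * k) by (apply Rmult_lt_0_compat; lra).
  set (A := fun u => d (a u) (b s)).
  assert (A0 : A 0 = s).
  { unfold A. rewrite H0. apply ray_length; [lra|exact Hb]. }
  assert (A1 : A (T + j) <= A T - j * (1 - k)).
  { specialize (HS s Hs1). rewrite He0 in HS. unfold A.
    pose proof (dist_triangle (eta j) (a (T + j)) (b s)) as Htri.
    rewrite (dist_sym (a (T + j)) (eta j)) in Htri. fold del in Htri. lra. }
  assert (Hconv : forall u v, 0 <= u -> 0 < v -> u <= v ->
             A u <= (1 - u / v) * A 0 + u / v * A v).
  { intros u v Hu Hv Huv.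
    assert (Hlam : 0 <= u / v <= 1).
    { split; [apply Rdiv_le_0_compat; lra|]. apply Rle_div_l; lra. }
    assert (Hcst : segment d (fun _ => b s) 0).
    { intros x y Hx Hy. replace x with y by lra. rewrite dist_refl, Rminus_diag, Rabs_R0.
      reflexivity. }
    pose proof (dist_convexity a (fun _ => b s) v 0 (u / v) (Rlt_le _ _ Hv) (Rle_refl 0)
                  (segment_of_ray _ _ Ha) Hcst Hlam) as H.
    replace (u / v * v) with u in H by (field; lra). exact H. }
  assert (A2 : A T <= s - T * (1 - k)).
  { pose proof (Hconv T (T + j) ltac:(lra) ltac:(lra) ltac:(lra)) as H. rewrite A0 in H.
    assert (H' : (T + j) * A T <= (T + j) * ((1 - T / (T + j)) * s + T / (T + j) * A (T + j)))
      by (apply Rmult_le_compat_l; lra).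
    replace ((T + j) * ((1 - T / (T + j)) * s + T / (T + j) * A (T + j)))
      with (j * s + T * A (T + j)) in H' by (field; lra).
    assert (T * A (T + j) <= T * (A T - j * (1 - k))) by (apply Rmult_le_compat_l; lra).
    apply Rmult_le_reg_l with j; lra. }
  assert (A3 : A t0 <= s - t0 * (1 - k)).
  { pose proof (Hconv t0 T ltac:(lra) ltac:(lra) ltac:(lra)) as H. rewrite A0 in H.
    assert (t0 / T * A T <= t0 / T * (s - T * (1 - k))).
    { apply Rmult_le_compat_l; [apply Rdiv_le_0_compat; lra|exact A2]. }
    replace (s - t0 * (1 - k))
      with ((1 - t0 / T) * s + t0 / T * (s - T * (1 - k))) by (field; lra).
    lra. }
  assert (Hlam : 0 <= t0 / s <= 1).
  { split; [apply Rdiv_le_0_compat; lra|]. apply Rle_div_l; lra. }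
  pose proof (stewart b s (a t0) (t0 / s) ltac:(lra) (segment_of_ray _ _ Hb) Hlam) as H.
  replace (t0 / s * s) with t0 in H by (field; lra). fold c in H.
  rewrite <- H0, (dist_sym (a t0) (a 0)), (ray_length a t0) in H by (lra || exact Ha).
  assert (Hsq : t0 / s * d (a t0) (b s) ^ 2 <= t0 / s * (s - t0 * (1 - k)) ^ 2).
  { apply Rmult_le_compat_l; [lra|]. apply pow_incr. split; [apply dist_nonneg|exact A3]. }
  (* Stewart now bounds [c ^ 2] by [3 * t0 ^ 2 * k], against [Hc2]; this is the origin of the 4 in
     the rate. *)
  assert (E : (1 - t0 / s) * t0 ^ 2 + t0 / s * (s - t0 * (1 - k)) ^ 2
              - t0 / s * (1 - t0 / s) * s ^ 2
              = 2 * t0 ^ 2 * k - 2 * (t0 / s) * t0 ^ 2 * k + t0 / s * (t0 * k) ^ 2)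
    by (field; lra).
  assert (H1 : 0 <= t0 / s * t0 ^ 2 * k).
  { apply Rmult_le_pos; [apply Rmult_le_pos; lra|lra]. }
  assert (H2 : t0 / s * (t0 * k) ^ 2 <= t0 * (t0 * k)).
  { replace (t0 / s * (t0 * k) ^ 2) with (t0 * (t0 * k) * ((t0 * k) / s)) by (field; lra).
    rewrite <- (Rmult_1_r (t0 * (t0 * k))) at 2.
    apply Rmult_le_compat_l; [apply Rmult_le_pos; lra|]. apply Rle_div_l; lra. }
  assert (0 < t0 ^ 2 * k) by (apply Rmult_lt_0_compat; lra).
  nra.
Qed.

(** * The rays [xi] and their dependence on the origin *)

Lemma xi_spec x a :
  cauchy_complete d -> is_ray d a ->
  is_ray d (xi d x a) /\ xi d x a 0 = x /\ asymp d a (xi d x a).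
Proof.
  intros Hc Ha. unfold xi. apply epsilon_spec. now apply ray_exists.
Qed.

Lemma xi_dist_le x y a t :
  cauchy_complete d -> is_ray d a -> 0 <= t -> d (xi d x a t) (xi d y a t) <= d x y.
Proof.
  intros Hc Ha Ht.
  destruct (xi_spec x a Hc Ha) as [R1 [Z1 A1]].
  destruct (xi_spec y a Hc Ha) as [R2 [Z2 A2]].
  rewrite <- Z1, <- Z2 at 2. apply asymp_dist_le; auto.
  apply asymp_trans with a; auto using asymp_sym.
Qed.

Lemma not_asymp_separated r r' :
  is_ray d r -> is_ray d r' -> r 0 = r' 0 -> ~ asymp d r r' ->
  exists t, 0 < t /\ 0 < d (r t) (r' t).
Proof.
  intros Hr Hr' H0 Hn. apply NNPP. intros Hno. apply Hn. exists 0. intros t Ht.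
  apply Rnot_lt_le. intros Hlt. apply Hno. exists t. split; [|exact Hlt].
  destruct Ht as [Ht|<-]; [exact Ht|]. rewrite H0, dist_refl in Hlt. lra.
Qed.

(** As the rays share their origin, [t] and [t'] differ by at most [2 * M]. Shrinking towards [q]
    scales both this and the gap [2 * M] between the endpoints by [u / t]. *)
Lemma common_origin_close r r' q y M t t' u :
  is_ray d r -> is_ray d r' -> r 0 = q -> r' 0 = q ->
  d (r t) y <= M -> d (r' t') y <= M -> 0 <= t' -> 0 <= u <= t -> 0 < t ->
  d (r u) (r' u) <= u / t * (4 * M).
Proof.
  intros Hr Hr' H0 H0' HM HM' Ht' Hu Ht.
  assert (Hd : d (r t) (r' t') <= 2 * M).
  { pose proof (dist_triangle y (r t) (r' t')). rewrite (dist_sym y) in H. lra. }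
  pose proof (ray_length r t (Rlt_le _ _ Ht) Hr) as L. rewrite H0 in L.
  pose proof (ray_length r' t' Ht' Hr') as L'. rewrite H0' in L'.
  assert (Htt : Rabs (t' - t) <= 2 * M).
  { pose proof (dist_triangle (r t) q (r' t')). pose proof (dist_triangle (r' t') q (r t)).
    rewrite (dist_sym (r' t') (r t)) in H1. apply Rabs_le. lra. }
  assert (Hlam : 0 <= u / t <= 1).
  { split; [apply Rdiv_le_0_compat; lra|]. apply Rle_div_l; lra. }
  pose proof (cone_convexity r r' t t' (u / t) (Rlt_le _ _ Ht) Ht'
    (segment_of_ray _ _ Hr) (segment_of_ray _ _ Hr') ltac:(congruence) Hlam) as H.
  replace (u / t * t) with u in H by (field; lra).
  assert (Hm : d (r' (u / t * t')) (r' u) <= u / t * (2 * M)).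
  { rewrite Hr'; [|apply Rmult_le_pos; lra|lra].
    replace (u / t * t' - u) with (u / t * (t' - t)) by (field; lra).
    rewrite Rabs_mult, Rabs_pos_eq by lra. apply Rmult_le_compat_l; lra. }
  assert (u / t * d (r t) (r' t') <= u / t * (2 * M)) by (apply Rmult_le_compat_l; lra).
  pose proof (dist_triangle (r' (u / t * t')) (r u) (r' u)). lra.
Qed.

(** The [g]-translate of the ray from [act h x] has the right origin and class, so uniqueness
    applies. *)
Lemma xi_ray_act {G : Type} (act : G -> X -> X) g h x a t :
  cauchy_complete d -> (forall x y, d (act g x) (act g y) = d x y) ->
  act g (act h x) = x -> is_ray d a -> 0 <= t ->
  xi d x (ray_act act g a) t = act g (xi d (act h x) a t).
Proof.
  intros Hc Hiso Hgh Ha Ht.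
  assert (Hray : forall r, is_ray d r -> is_ray d (ray_act act g r)).
  { intros r Hr u v Hu Hv. unfold ray_act. rewrite Hiso. auto. }
  destruct (xi_spec x (ray_act act g a) Hc (Hray a Ha)) as [R1 [Z1 A1]].
  destruct (xi_spec (act h x) a Hc Ha) as [R2 [Z2 [C HC]]].
  apply (asymp_unique _ (ray_act act g (xi d (act h x) a))); auto.
  - apply asymp_trans with (ray_act act g a); [now apply asymp_sym|].
    exists C. intros u Hu. unfold ray_act. rewrite Hiso. auto.
  - rewrite Z1. unfold ray_act. rewrite Z2. auto.
Qed.

End CAT0Geometry.

(** * The truncated series in the boundary metric *)

Lemma half_pow_eq n : / 2 ^ S n = / 2 * (/ 2) ^ n.
Proof. rewrite <- pow_inv. reflexivity. Qed.

Lemma inv_pow2_pos n : 0 < / 2 ^ n.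
Proof. apply Rinv_0_lt_compat, pow_lt. lra. Qed.

Lemma ex_series_inv_pow2 : ex_series (fun n => / 2 ^ S n).
Proof.
  apply ex_series_ext with (fun n => scal (/ 2) ((/ 2) ^ n)).
  - intros n. rewrite half_pow_eq. reflexivity.
  - apply (ex_series_scal_l (V := R_NormedModule)). apply ex_series_geom.
    rewrite Rabs_pos_eq; lra.
Qed.

Lemma Series_inv_pow2 : Series (fun n => / 2 ^ S n) = 1.
Proof.
  rewrite (Series_ext _ (fun n => / 2 * (/ 2) ^ n)) by apply half_pow_eq.
  rewrite Series_scal_l, Series_geom; [field|]. rewrite Rabs_pos_eq; lra.
Qed.

Lemma Series_nonneg (a : nat -> R) :
  (forall n, 0 <= a n) -> ex_series a -> 0 <= Series a.
Proof.
  intros Ha Hex. rewrite <- (Rmult_0_l (Series a)), <- Series_scal_l.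
  apply Series_le; [|exact Hex]. intros n. specialize (Ha n). lra.
Qed.

Section TruncatedSeries.
Context (f : nat -> R) (Hf : forall n, 0 <= f n).

Let a n := Rmin (f n) (/ 2 ^ S n).

Lemma truncated_bounds n : 0 <= a n <= / 2 ^ S n.
Proof.
  split; [|apply Rmin_r].
  apply Rmin_glb; [apply Hf|apply Rlt_le, inv_pow2_pos].
Qed.

Lemma ex_series_truncated : ex_series a.
Proof.
  apply (ex_series_le (K := R_AbsRing) (V := R_CompleteNormedModule) a
           (fun n => / 2 ^ S n)); [|apply ex_series_inv_pow2].
  intros n. change (norm (a n)) with (Rabs (a n)).
  pose proof (truncated_bounds n). rewrite Rabs_pos_eq; lra.
Qed.

Lemma truncated_series_nonneg : 0 <= Series a.
Proof.
  apply Series_nonneg; [intros n; apply truncated_bounds|apply ex_series_truncated].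
Qed.

Lemma truncated_series_ge k : Rmin (f k) (/ 2 ^ S k) <= Series a.
Proof.
  rewrite (Series_incr_n a (S k)); [|lia|apply ex_series_truncated].
  assert (0 <= Series (fun i => a (S k + i)%nat)).
  { apply Series_nonneg; [intros n; apply truncated_bounds|].
    apply (ex_series_incr_n a (S k)), ex_series_truncated. }
  assert (a k <= sum_f_R0 a k).
  { destruct k; [apply Rle_refl|]. simpl sum_f_R0.
    pose proof (cond_pos_sum a k (fun n => proj1 (truncated_bounds n))). lra. }
  change (Rmin (f k) (/ 2 ^ S k)) with (a k). simpl Nat.pred. lra.
Qed.

(** The first [S N] terms are at most [q]; the tail is dominated by a geometric series. *)
Lemma truncated_series_le N q :
  (forall n, (n <= N)%nat -> f n <= q) -> Series a <= q * INR (S N) + / 2 ^ S N.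
Proof.
  intros Hq. rewrite (Series_incr_n a (S N)); [|lia|apply ex_series_truncated].
  apply Rplus_le_compat.
  - simpl Nat.pred. rewrite <- sum_cte. apply sum_Rle. intros n Hn.
    eapply Rle_trans; [apply Rmin_l|auto].
  - rewrite <- (Rmult_1_r (/ 2 ^ S N)), <- Series_inv_pow2, <- Series_scal_l.
    apply Series_le.
    + intros n. pose proof (truncated_bounds (S N + n)) as H.
      replace (S (S N + n)) with (S N + S n)%nat in H by lia.
      now rewrite pow_add, Rinv_mult in H.
    + apply (ex_series_scal_l (V := R_NormedModule)), ex_series_inv_pow2.
Qed.

End TruncatedSeries.

(** * Limits along complements of finite sets *)

Lemma limsupG_ge {G : Type} (f : G -> R) c :
  (forall F : list G, exists g, ~ In g F /\ c <= f g) -> Rbar_le c (limsupG f).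
Proof.
  intros H. unfold limsupG.
  match goal with |- Rbar_le _ (Rbar_glb ?E) =>
    destruct (proj2_sig (Rbar_ex_glb E)) as [_ Hg]; apply Hg end.
  intros y [F ->]. destruct (H F) as [g [Hg' Hc]].
  apply Rbar_le_trans with (f g); [exact Hc|].
  match goal with |- Rbar_le _ (Rbar_lub ?E) =>
    destruct (proj2_sig (Rbar_ex_lub E)) as [Hu _]; apply Hu end.
  now exists g.
Qed.

(** Every infimum outside a finite set is [0], so the supremum runs over this single value; the
    empty list shows that it occurs. *)
Lemma liminfG_eq0 {G : Type} (f : G -> R) :
  (forall g, 0 <= f g) ->
  (forall (F : list G) eps, 0 < eps -> exists g, ~ In g F /\ f g <= eps) ->
  liminfG f = 0.
Proof.
  intros Hf H. unfold liminfG. apply Rbar_is_lub_unique.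
  assert (Hglb : forall F : list G,
    Rbar_glb (fun z => exists g, ~ In g F /\ z = Finite (f g)) = 0).
  { intros F. apply Rbar_is_glb_unique. split.
    - intros z [g [_ ->]]. apply Hf.
    - intros b Hb.
      assert (Hb' : forall eps, 0 < eps -> Rbar_le b eps).
      { intros eps Heps. destruct (H F eps Heps) as [g [Hg Hle]].
        apply Rbar_le_trans with (f g); [apply Hb; now exists g|exact Hle]. }
      destruct b as [b| |]; [|destruct (Hb' 1 Rlt_0_1)|exact I].
      simpl. apply le_epsilon. intros eps Heps. rewrite Rplus_0_l. now apply Hb'. }
  split.
  - intros y [F ->]. rewrite Hglb. apply Rle_refl.
  - intros b Hb. apply Hb. exists nil. now rewrite Hglb.
Qed.

(** * The two conditions of a scrambled set *)

Section Scrambled.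
Context {G : Type} (mul : G -> G -> G) (e : G) (inv : G -> G)
  {X : Type} (d : X -> X -> R) (act : G -> X -> X) (x0 : X)
  (Hgrp : is_group mul e inv) (Hcat : CAT0 d) (Hgeom : geometric_action d mul e act).

Let Hcomplete : cauchy_complete d := geometric_complete d Hcat mul e inv act Hgrp Hgeom.

Lemma act_isometry g x y : d (act g x) (act g y) = d x y.
Proof. apply Hgeom. Qed.

Lemma act_inv g x : act (inv g) (act g x) = x.
Proof.
  destruct (proj1 Hgeom) as [H1 [H2 _]]. rewrite <- H2.
  now rewrite (proj1 (proj2 (proj2 Hgrp) g)), H1.
Qed.

(** Used contrapositively: if [g] moves [x0] farther than [B], then [inv g] lies outside [F]. *)
Lemma orbit_finite_bound (F : list G) :
  exists B, forall g, In (inv g) F -> d (act g x0) x0 <= B.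
Proof.
  assert (H : exists B, forall h, In h F -> d x0 (act h x0) <= B).
  { induction F as [|f F [B HB]]; [now exists 0|].
    exists (Rmax B (d x0 (act f x0))). intros h [<-|Hh]; [apply Rmax_r|].
    eapply Rle_trans; [now apply HB|apply Rmax_l]. }
  destruct H as [B HB]. exists B. intros g Hg.
  rewrite <- (act_isometry (inv g)), act_inv. now apply HB.
Qed.

(** Shifts the group element from the boundary points to the origin, so that only rays towards fixed
    [a] and [b] are compared. *)
Lemma dbd_terms g a b n :
  is_ray d a -> is_ray d b ->
  d (xi d x0 (ray_act act (inv g) a) (INR n)) (xi d x0 (ray_act act (inv g) b) (INR n))
  = d (xi d (act g x0) a (INR n)) (xi d (act g x0) b (INR n)).
Proof.
  intros Ha Hb.
  rewrite !(xi_ray_act d Hcat act (inv g) g) by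
    auto using act_isometry, act_inv, pos_INR.
  apply act_isometry.
Qed.

Lemma limsup_dbd_pos a b :
  is_ray d a -> is_ray d b -> ~ asymp d a b ->
  Rbar_lt 0 (limsupG (fun g => dbd d x0 (ray_act act g a) (ray_act act g b))).
Proof.
  intros Ha Hb Hab.
  destruct (xi_spec d Hcat x0 a Hcomplete Ha) as [Ra [Za Aa]].
  destruct (xi_spec d Hcat x0 b Hcomplete Hb) as [Rb [Zb Ab]].
  set (al := xi d x0 a) in *. set (be := xi d x0 b) in *.
  destruct (not_asymp_separated d Hcat al be Ra Rb ltac:(congruence)) as [t0 [Ht0 Hc]].
  { intros Has. apply Hab. apply (asymp_trans d Hcat al); [exact Aa|].
    apply (asymp_trans d Hcat be); [exact Has|]. now apply asymp_sym. }
  set (k := d (al t0) (be t0) ^ 2 / (4 * t0 ^ 2)).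
  assert (Hk : 0 < k).
  { apply Rdiv_lt_0_compat; [now apply pow_lt|].
    apply Rmult_lt_0_compat; [lra|now apply pow_lt]. }
  destruct (proj2 (proj2 Hgeom)) as [K [HK Hcov]].
  destruct (compact_bounded d Hcat K x0 HK) as [D [HD0 HD]].
  (* At time [S n] the divergence exceeds [2 * D + 1]: moving the origin from [al T] to the orbit
     costs [D] for each ray, and [1] must remain. *)
  destruct (INR_large ((2 * D + 1) / k)) as [n Hn].
  specialize (Hn (S n) ltac:(lia)). apply Rlt_div_l in Hn; [|exact Hk].
  (* This is the truncation of the term of index [n], which belongs to time [S n]; it does not
     depend on [F]. *)
  apply Rbar_lt_le_trans with (/ 2 ^ S n); [apply inv_pow2_pos|].
  apply limsupG_ge. intros F.
  destruct (orbit_finite_bound F) as [B HB].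
  (* [rays_diverge] requires [t0 <= T]; [D + B + 1] takes [act g x0] farther than [B] from [x0]. *)
  set (T := Rmax t0 (D + B + 1)).
  assert (HT1 : t0 <= T) by apply Rmax_l.
  assert (HT2 : D + B + 1 <= T) by apply Rmax_r.
  destruct (Hcov (al T)) as [g [y [Hy Hgy]]].
  assert (Hnear : d (act g x0) (al T) <= D)
    by (rewrite Hgy, act_isometry; now apply HD).
  exists (inv g). split.
  - intros Hin. specialize (HB g Hin).
    pose proof (ray_length d al T ltac:(lra) Ra) as L. rewrite Za in L.
    pose proof (dist_triangle d Hcat (act g x0) x0 (al T)) as H.
    rewrite (dist_sym d Hcat x0 (act g x0)) in H. lra.
  - unfold dbd.
    eapply Rle_trans;
      [|apply (truncated_series_ge
          (fun m => d (xi d x0 (ray_act act (inv g) a) (INR (S m)))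
                      (xi d x0 (ray_act act (inv g) b) (INR (S m))))) with (k := n);
        intros m; now apply dist_nonneg].
    cbv beta. rewrite dbd_terms by assumption.
    apply Rmin_glb; [|apply Rle_refl].
    apply Rle_trans with 1.
    { rewrite <- Rinv_1. apply Rinv_le_contravar; [lra|]. apply pow_R1_Rle. lra. }
    set (p := al T) in *.
    destruct (xi_spec d Hcat p b Hcomplete Hb) as [Rp [Zp Ap]].
    assert (Hj : 0 < INR (S n)) by (apply lt_0_INR; lia).
    pose proof (rays_diverge d Hcat al be (xi d p b) t0 T (INR (S n)) Ra Rb
      ltac:(congruence) ltac:(lra) Hj Rp Zp) as Hdiv.
    specialize (Hdiv ltac:(apply (asymp_trans d Hcat b); auto using asymp_sym)).
    fold k in Hdiv.
    destruct (xi_spec d Hcat p a Hcomplete Ha) as [Rpa [Zpa Apa]].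
    (* Past time [T], [al] is itself the ray from [p] towards [a]. *)
    assert (Eq : al (T + INR (S n)) = xi d p a (INR (S n))).
    { apply (asymp_unique d Hcat (fun u => al (T + u))); auto.
      - apply ray_shift; [lra|exact Ra].
      - apply (asymp_trans d Hcat al).
        + exists T. intros u Hu. rewrite Ra by lra. rewrite Rabs_pos_eq; lra.
        + apply (asymp_trans d Hcat a); [now apply asymp_sym|exact Apa].
      - now rewrite Rplus_0_r, Zpa.
      - apply pos_INR. }
    rewrite Eq in Hdiv.
    pose proof (xi_dist_le d Hcat (act g x0) p a _ Hcomplete Ha (pos_INR (S n))) as Da.
    pose proof (xi_dist_le d Hcat (act g x0) p b _ Hcomplete Hb (pos_INR (S n))) as Db.
    set (J := INR (S n)) in *.
    pose proof (dist_triangle d Hcat (xi d (act g x0) b J) (xi d p b J) (xi d p a J)) as T1.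
    pose proof (dist_triangle d Hcat (xi d (act g x0) a J) (xi d (act g x0) b J)
                  (xi d p a J)) as T2.
    rewrite (dist_sym d Hcat (xi d p b J) (xi d (act g x0) b J)) in T1.
    rewrite (dist_sym d Hcat (xi d (act g x0) b J) (xi d (act g x0) a J)) in T2.
    lra.
Qed.

Lemma liminf_dbd_zero a b M (gs : nat -> G) (y0 : X) :
  is_ray d a -> is_ray d b ->
  is_lim_seq (fun i => d y0 (act (gs i) x0)) p_infty ->
  (forall i,
     (exists t, 0 <= t /\ d (xi d (act (gs i) x0) a t) y0 <= M) /\
     (exists t, 0 <= t /\ d (xi d (act (gs i) x0) b t) y0 <= M)) ->
  liminfG (fun g => dbd d x0 (ray_act act g a) (ray_act act g b)) = 0.
Proof.
  intros Ha Hb Hlim HM. apply liminfG_eq0.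
  { intros g. apply truncated_series_nonneg. intros n. now apply dist_nonneg. }
  intros F eps Heps.
  destruct (orbit_finite_bound F) as [B HB].
  destruct (pow_lt_1_zero (/ 2) ltac:(rewrite Rabs_pos_eq; lra) (eps / 2) ltac:(lra))
    as [N HN].
  specialize (HN (S N) ltac:(lia)). rewrite pow_inv in HN.
  rewrite Rabs_pos_eq in HN by apply Rlt_le, inv_pow2_pos.
  set (U := INR (S N)). assert (HU : 0 < U) by (apply lt_0_INR; lia).
  assert (HM0 : 0 <= M).
  { destruct (HM 0%nat) as [[t [_ Ht]] _].
    eapply Rle_trans; [apply (dist_nonneg d Hcat)|exact Ht]. }
  (* The least [t] for which [4 * M * U * U / t] is at most [eps / 2]; the tail takes the other half
     of [eps]. *)
  set (W := 8 * M * U * U / eps).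
  assert (HW : 0 <= W).
  { apply Rdiv_le_0_compat; [|exact Heps]. repeat apply Rmult_le_pos; lra. }
  apply is_lim_seq_spec in Hlim.
  (* The first bound puts [inv g] outside [F]; the second forces [U + W < t], as [t] is at least the
     distance from [act g x0] to [y0] minus [M]. *)
  destruct (Hlim (Rmax (B + d y0 x0) (M + U + W))) as [i Hi].
  specialize (Hi i (le_n _)). cbv beta in Hi.
  pose proof (Rmax_l (B + d y0 x0) (M + U + W)) as Hmax1.
  pose proof (Rmax_r (B + d y0 x0) (M + U + W)) as Hmax2.
  set (g := gs i) in *. exists (inv g). split.
  - intros Hin. specialize (HB g Hin).
    pose proof (dist_triangle d Hcat x0 y0 (act g x0)) as H.
    rewrite (dist_sym d Hcat x0 (act g x0)) in H. lra.
  - destruct (HM i) as [[t [Ht Hta]] [t' [Ht' Htb]]]. fold g in Hta, Htb.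
    destruct (xi_spec d Hcat (act g x0) a Hcomplete Ha) as [Ra [Za _]].
    destruct (xi_spec d Hcat (act g x0) b Hcomplete Hb) as [Rb [Zb _]].
    assert (Htbig : U + W < t).
    { pose proof (ray_length d _ t Ht Ra) as L. rewrite Za in L.
      pose proof (dist_triangle d Hcat (xi d (act g x0) a t) y0 (act g x0)) as H.
      rewrite (dist_sym d Hcat y0 (xi d (act g x0) a t)),
        (dist_sym d Hcat (xi d (act g x0) a t) (act g x0)) in H. lra. }
    eapply Rle_trans.
    { apply (truncated_series_le
          (fun m => d (xi d x0 (ray_act act (inv g) a) (INR (S m)))
                      (xi d x0 (ray_act act (inv g) b) (INR (S m))))) with
        (N := N) (q := U / t * (4 * M)).
      - intros m. now apply dist_nonneg.
      - intros m Hm. rewrite dbd_terms by assumption.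
        assert (Hm' : INR (S m) <= U) by (apply le_INR; lia).
        pose proof (pos_INR (S m)).
        eapply Rle_trans.
        + apply (common_origin_close d Hcat _ _ (act g x0) y0 M t t'); auto; lra.
        + apply Rmult_le_compat_r; [lra|]. apply Rmult_le_compat_r; [|exact Hm'].
          apply Rlt_le, Rinv_0_lt_compat. lra. }
    fold U.
    assert (Hfirst : U / t * (4 * M) * U <= eps / 2).
    { replace (U / t * (4 * M) * U) with (4 * M * U * U / t) by (field; lra).
      apply Rle_div_l; [lra|].
      assert (HWt : W <= t) by lra. unfold W in HWt.
      apply Rle_div_l in HWt; [lra|exact Heps]. }
    lra.
Qed.

End Scrambled.

Theorem theorem3p2
  (G : Type) (mul : G -> G -> G) (e : G) (inv : G -> G)
  (X : Type) (d : X -> X -> R) (act : G -> X -> X) (x0 : X) :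
  is_group mul e inv ->
  CAT0 d ->
  geometric_action d mul e act ->
  (* |∂X| > 2 *)
  (exists a b c, is_ray d a /\ is_ray d b /\ is_ray d c /\
     ~ asymp d a b /\ ~ asymp d b c /\ ~ asymp d a c) ->
  (exists M, 0 < M /\
     forall a b, is_ray d a -> is_ray d b -> ~ asymp d a b ->
       exists (gs : nat -> G) (y0 : X),
         is_lim_seq (fun i => d y0 (act (gs i) x0)) p_infty /\
         forall i : nat,
           (exists t, 0 <= t /\ d (xi d (act (gs i) x0) a t) y0 <= M) /\
           (exists t, 0 <= t /\ d (xi d (act (gs i) x0) b t) y0 <= M)) ->
  scrambled d act x0.
Proof.
  intros Hgrp Hcat Hgeom _ [M [_ HM]] a b Ha Hb Hab. split.
  - exact (limsup_dbd_pos mul e inv d act x0 Hgrp Hcat Hgeom a b Ha Hb Hab).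
  - destruct (HM a b Ha Hb Hab) as [gs [y0 [Hlim Hgs]]].
    exact (liminf_dbd_zero mul e inv d act x0 Hgrp Hcat Hgeom a b M gs y0 Ha Hb Hlim Hgs).
Qed.
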